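(* Let $M$ be a nonempty topological manifold. Then the cone $CM$ is not a topological manifold (of any dimension).
   Context: A topological manifold of dimension $n$ is a topological space $M$ that is second countable, Hausdorff and locally Euclidean of dimension $n$: every $p \in M$ has an open neighborhood $U \subseteq M$ that is homeomorphic to $\mathbb{R}^n$. In particular, manifolds are without boundary; they are not assumed compact or connected. A topological manifold is a space that is a topological manifold of dimension $m$ for some $m \geq 0$. For a topological space $X$, the cone $CX$ is the quotient space $(X \times [0,1])/(X \times \{1\})$, obtained from $X \times [0,1]$ by collapsing the subspace $X \times \{1\}$ to a single point, with the quotient topology. *)

(* Defs.v *)
From HB Require Import structures.
From mathcomp Require Import all_boot all_order all_algebra.
From mathcomp Require Import generic_quotient.
From mathcomp Require Import all_classical all_reals all_analysis.

Set Implicit Arguments.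
Unset Strict Implicit.
Unset Printing Implicit Defensive.

Import Order.TTheory GRing.Theory Num.Theory.
Import numFieldNormedType.Exports.

Local Open Scope classical_set_scope.
Local Open Scope ring_scope.
Local Open Scope quotient_scope.

Definition homeomorphic (X Y : topologicalType) : Prop :=
  exists (f : X -> Y) (g : Y -> X),
    [/\ continuous f, continuous g, cancel f g & cancel g f].

(* [set_type U] carries the topology induced from [X], unlike [subspace U],
   whose carrier is the whole of [X]. *)
Definition locally_euclidean (R : realType) (n : nat) (X : topologicalType) :
    Prop :=
  forall p : X, exists U : set X,
    [/\ open U, U p & homeomorphic (set_type U) 'rV[R]_n].

Definition topological_manifold_of_dim (R : realType) (n : nat)
    (X : topologicalType) : Prop :=
  [/\ @second_countable X, hausdorff_space X & locally_euclidean R n X].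

Definition topological_manifold (R : realType) (X : topologicalType) : Prop :=
  exists n : nat, topological_manifold_of_dim R n X.

Section collapse.
Context {X : topologicalType} (A : set X).

Definition collapse_rel (x y : X) : bool :=
  (x == y) || (x \in A) && (y \in A).

Lemma collapse_rel_refl : reflexive collapse_rel.
Proof. by move=> x; rewrite /collapse_rel eqxx. Qed.

Lemma collapse_rel_sym : symmetric collapse_rel.
Proof. by move=> x y; rewrite /collapse_rel eq_sym andbC. Qed.

Lemma collapse_rel_trans : transitive collapse_rel.
Proof.
move=> y x z; rewrite /collapse_rel.
by move=> /predU1P[->//|/andP[xA yA]] /predU1P[<-|/andP[_ zA]];
  rewrite xA ?yA ?zA orbT.
Qed.

Canonical collapse_equiv :=
  EquivRel collapse_rel collapse_rel_refl collapse_rel_sym collapse_rel_trans.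

Definition collapse : topologicalType :=
  quotient_topology {eq_quot collapse_equiv}.

End collapse.

(* The factor [`[0, 1]] is the set type of the unit interval of [R], with the
   induced topology. *)
Definition cone (R : realType) (X : topologicalType) : topologicalType :=
  collapse [set p : X * `[0, 1 : R]%classic | \val p.2 = 1].

(* Main.v *)
Require Import Defs.
From mathcomp Require Import all_boot all_order all_algebra all_fingroup.
From mathcomp Require Import generic_quotient.
From mathcomp Require Import all_classical all_reals all_analysis.
From mathcomp Require Import lra.

(** Near a base point [q = (p, 0)] the cone looks like [M x [0, 1)], so points
can be pushed upwards, off the base, by an arbitrarily small motion.  In a
Euclidean space no such motion exists.  Suppose an open neighbourhood of [q]
were homeomorphic to [R^n].  Multiply the height of the push by a tent function
supported in a small cube around the image of [q], positive at its centre and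
zero on its boundary.  Read in the chart, the push becomes a continuous map from
the cube to [R^n] which is the identity on the boundary of the cube, and whose
image misses the centre, because a pushed point never lies at the point [q] of
the base ([raise_eq_base]).  The Poincare-Miranda theorem ([poincare_miranda]),
a form of Brouwer's theorem, forbids this.  The argument is local at one base
point and works in all dimensions at once, without invariance of domain.

The Poincare-Miranda theorem is reduced by compactness to a statement about a
grid of points of the cube, each carrying for every coordinate direction [a] a
label in [F_2], equal to 0 on the face [x a = 0] and to 1 on the opposite face:
some small grid cube sees both labels in every direction
([ex_fully_labelled]).  To prove this, cut each grid cube into the simplices of
the Freudenthal triangulation, with ordered vertices [v_0, ..., v_n], and count
modulo 2 the simplices along which every label changes at its own step, that is,
integrate the cup product of the coboundaries of the labels, whose value on a
simplex is [prod_i (f_i(v_i) + f_i(v_(i+1)))].  Replacing one label by another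
with the same boundary values alters the integrand by a coboundary
([diff_prod_replace]) of a cochain that vanishes on the boundary of the big
cube, so by Stokes' formula ([stokes]) the count does not change.  For the
labels [0 < x a] exactly one simplex is counted.  Hence the count is always 1,
and a counted simplex exists. *)

Set Implicit Arguments.
Unset Strict Implicit.
Unset Printing Implicit Defensive.

Import Order.TTheory GRing.Theory Num.Theory.
Import numFieldNormedType.Exports.

Local Open Scope classical_set_scope.
Local Open Scope ring_scope.
Local Open Scope quotient_scope.

(** * Cochains modulo 2 on ordered simplices *)

Lemma addF2K (x : 'F_2) : x + x = 0.
Proof. by apply: addrr_pchar2; exact: pchar_Fp. Qed.

Section Cochains.
Variable V : Type.
Implicit Types (f : nat -> V -> 'F_2) (h : V -> 'F_2) (w : nat -> V).
Implicit Types (a : (nat -> V) -> 'F_2).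

(** An ordered simplex is given by the sequence [w] of its vertices, continued
arbitrarily: a cochain of degree [d] reads the entries [w 0, ..., w d] only.
[cup_diffs k f a] is the cup product of the coboundaries of the 0-cochains
[f 0, ..., f k.-1] with the cochain [a]. *)
Definition cup_diffs k f a w : 'F_2 :=
  (\prod_(i < k) (f i (w i) + f i (w i.+1))) * a (fun j => w (k + j)%N).

(** The faces of a simplex with vertices [w 0, ..., w m] are obtained by deleting
one vertex, so this is the simplicial coboundary; signs disappear modulo 2. *)
Definition cobound m a w : 'F_2 := \sum_(i < m.+1) a (fun j => w (bump i j)).

Lemma cup_diffsS k f a w :
  cup_diffs k.+1 f a w =
  cup_diffs k f
    (fun u => (f k (u 0) + f k (u 1)) * a (fun j => u j.+1)) w.
Proof.
rewrite /cup_diffs big_ord_recr /= mulrA addn0 addn1; congr (_ * a _).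
by apply/funext => j; rewrite addSnnS.
Qed.

(** Leibniz rule for a product whose left factor is the coboundary of [g], hence
a cocycle.  The two faces that delete [w 0] or [w 1] share the same value of
[a], and their left factors add up by the cocycle condition. *)
Lemma cobound_diff m g a w :
  cobound m.+1 (fun u => (g (u 0) + g (u 1)) * a (fun j => u j.+1)) w =
  (g (w 0) + g (w 1)) * cobound m a (fun j => w j.+1).
Proof.
rewrite /cobound !big_ord_recl /= addrA mulrDr mulr_sumr; congr (_ + _).
  (* deleting either of the first two vertices leaves the tail from [w 2] on *)
  have tail i : (i < 2)%N -> a (fun j => w (bump i j.+1)) = a (fun j => w j.+2).
    by case: i => [|[|i]] // _; congr a; apply/funext => j.
  rewrite !tail // /bump /= -mulrDl; congr (_ * a _).
  by rewrite addrACA addF2K addr0 addrC.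
apply: eq_bigr => i _; congr (_ * a _).
by apply/funext => j; rewrite -bumpS.
Qed.

Lemma cobound_cup_diffs k m f a w :
  cobound (k + m) (cup_diffs k f a) w = cup_diffs k f (cobound m a) w.
Proof.
elim: k m a => [|k IH] m a.
  rewrite /cobound /cup_diffs big_ord0 mul1r; apply: eq_bigr => i _.
  by rewrite big_ord0 mul1r.
rewrite cup_diffsS.
under [LHS]eq_bigr do rewrite cup_diffsS.
rewrite addSnnS [LHS]IH; congr (_ * _); exact: cobound_diff.
Qed.

(** A cup product of cocycles is a cocycle: the Leibniz rule moves the coboundary
to the unit 0-cochain, where it counts two faces. *)
Lemma cobound_diffs m f w : cobound m.+1 (cup_diffs m f (fun=> 1)) w = 0.
Proof.
rewrite -[m.+1]addn1 cobound_cup_diffs /cup_diffs /cobound.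
by rewrite !big_ord_recl big_ord0 addr0 addF2K mulr0.
Qed.

Lemma cobound_cup_h m h f w :
  cobound m.+1 (fun u => h (u 0) * cup_diffs m f (fun=> 1) u) w =
  (h (w 0) + h (w 1)) * cup_diffs m f (fun=> 1) (fun j => w j.+1).
Proof.
have := cobound_diffs m f w.
rewrite /cobound !(big_ord_recl (m.+1)) /= => /eqP; rewrite addr_eq0 => /eqP E.
rewrite (eq_bigr (fun i : 'I_m.+1 => h (w 0) *
   cup_diffs m f (fun=> 1) (fun j => w (bump (lift ord0 i) j)))) //.
rewrite -mulr_sumr -[X in h (w 0) * X]opprK -E mulrN.
rewrite -mulNr -mulrDl addrC; congr (_ * _); congr (_ + _).
by apply/eqP; rewrite eq_sym -addr_eq0 addF2K.
Qed.

(** In a cup product of cocycles and of one 0-cochain [h], the coboundary acts on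
[h] alone. *)
Lemma cobound_cup_diffs_h k m h f f' w :
  cobound (k + m.+1)
    (cup_diffs k f (fun u => h (u 0) * cup_diffs m f' (fun=> 1) u)) w =
  cup_diffs k f (fun u => (h (u 0) + h (u 1)) *
     cup_diffs m f' (fun=> 1) (fun j => u j.+1)) w.
Proof. by rewrite cobound_cup_diffs; congr (_ * _); exact: cobound_cup_h. Qed.

End Cochains.

(** * Stokes' formula on the Freudenthal triangulation *)

Section Grid.
Variables n N : nat.
Local Notation dim := n.+1.
(* A simplex is a grid cube, given by its lowest corner, and the order in which
   a monotone path to the opposite corner increases the coordinates: [s.2 c] is
   the step at which coordinate [c] increases. *)
Local Notation simplex := ({ffun 'I_dim -> 'I_N.+1} * 'S_dim)%type.
Local Notation point := ('I_dim -> nat).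

Definition vertex (s : simplex) (i : nat) : point :=
  fun c => (s.1 c + (s.2 c < i))%N.

(** The two paths that differ by the order of two consecutive steps share the
face opposite to the vertex between these steps; one of the two permutations is
odd and the other even, so these faces cancel in pairs. *)
Lemma sum_swap (j : nat) (F : simplex -> 'F_2) : (j < n)%N ->
  (forall b (r : 'S_dim),
     F (b, (r * tperm (inord j) (inord j.+1))%g) = F (b, r)) ->
  \sum_s F s = 0.
Proof.
move=> jn FE; pose t : 'S_dim := tperm (inord j) (inord j.+1).
pose phi (s : simplex) : simplex := (s.1, (s.2 * t)%g).
have phiK : involutive phi.
  by move=> [b r]; rewrite /phi /= -mulgA tperm2 mulg1.
have tE : odd_perm t.
  rewrite odd_tperm; apply/eqP => /(congr1 val) /=.
  by rewrite !inordK ?ltnS ?(ltnW jn) // => /eqP; rewrite ltn_eqF.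
rewrite (bigID (fun s : simplex => odd_perm s.2)) /=.
rewrite [X in X + _](reindex_inj (inv_inj phiK)) /=.
rewrite [X in X + _](eq_big (fun s : simplex => ~~ odd_perm s.2) F).
- by rewrite addF2K.
- by move=> s /=; rewrite odd_permM tE addbT.
- by move=> [b r] _; rewrite /phi /= FE.
Qed.

(** The simplex on the other side of the face opposite to the first vertex: the
step that came first is taken last, starting one unit further in its direction.
The lowest corner moves cyclically ([ordS]), so that this is a bijection of all
simplices; it leaves the triangulated cube exactly when it wraps around. *)
Definition next_simplex (s : simplex) : simplex :=
  ([ffun c => if s.2 c == ord0 then ordS (s.1 c) else s.1 c],
   (s.2 * perm (@ord_pred_inj dim))%g).

Lemma next_simplex_inj : injective next_simplex.
Proof.
move=> [b r] [b' r'] [/ffunP eb /mulIg er]; congr (_, _) => //.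
apply/ffunP => c; have := eb c; rewrite !ffunE /= er.
by case: ifP => // _ /ordS_inj.
Qed.

Lemma vertex_next (s : simplex) a i : s.2 a = ord0 -> (s.1 a < N)%N ->
  (i < dim)%N -> vertex (next_simplex s) i = vertex s i.+1.
Proof.
move=> sa sN idim; apply/funext => c.
rewrite /vertex /next_simplex /= ffunE permM permE /=.
case: eqP => [s0|/eqP s0].
  have -> : c = a by apply: (@perm_inj _ s.2); rewrite sa.
  rewrite sa /= modn_small ?ltnS // (modn_small (ltnSn n)).
  rewrite [(n < i)%N]ltnNge -ltnS idim.
  by rewrite addn0 addn1.
have : (0 < s.2 c)%N by rewrite lt0n.
case: (s.2 c) => [[|k] kn] //= _.
by rewrite modnDr modn_small ?(ltnW kn).
Qed.

Lemma vertex_last_face (s : simplex) a i : s.2 a = ord0 -> s.1 a = N :> nat ->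
  vertex s i.+1 a = N.+1.
Proof. by move=> sa sN; rewrite /vertex sa sN addn1. Qed.

Lemma vertex_next_first_face (s : simplex) a i :
  s.2 a = ord0 -> s.1 a = N :> nat -> (i < dim)%N ->
  vertex (next_simplex s) i a = 0%N.
Proof.
move=> sa sN idim; rewrite /vertex /= ffunE permM permE /= sa eqxx /= sN modnn.
by rewrite modn_small // [(n < i)%N]ltnNge -ltnS idim.
Qed.

(** The inner faces cancel by [sum_swap], and the first face of each simplex
cancels against the last face of [next_simplex].  When [next_simplex] wraps
around, these two faces lie in opposite sides of the big cube. *)
Lemma stokes (c : (nat -> point) -> 'F_2) :
  (forall w w', (forall i, (i < dim)%N -> w i = w' i) -> c w = c w') ->
  (forall a w, (forall i, (i < dim)%N -> w i a = 0%N) -> c w = 0) ->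
  (forall a w, (forall i, (i < dim)%N -> w i a = N.+1) -> c w = 0) ->
  \sum_s cobound dim c (vertex s) = 0.
Proof.
move=> cext c0 cN.
rewrite exchange_big big_ord_recl big_ord_recr /=.
rewrite [X in _ + (X + _)]big1 ?add0r => [|i _]; last first.
  apply: (@sum_swap i) => // b r; congr c; apply/funext => j.
  apply/funext => k; rewrite /vertex /= permM; congr (_ + nat_of_bool _)%N.
  have : bump (bump 0 i) j != i.+1 by rewrite eq_sym; exact: neq_bump.
  have i1 : (inord i : 'I_dim) = i :> nat by rewrite inordK // ltnS ltnW.
  have i2 : (inord i.+1 : 'I_dim) = i.+1 :> nat by rewrite inordK ?ltnS.
  case: tpermP => [->|->|//]; rewrite ?i1 ?i2 => ne.
    by rewrite [RHS]leq_eqVlt [_ == bump _ _]eq_sym (negbTE ne).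
  by rewrite [LHS]leq_eqVlt [_ == bump _ _]eq_sym (negbTE ne).
rewrite [X in _ + X](reindex_inj next_simplex_inj) -big_split /=.
apply: big1 => s _; pose a := (s.2^-1)%g ord0.
have sa : s.2 a = ord0 by rewrite permKV.
have [sN|] := ltnP (s.1 a) N.
  rewrite (cext _ (fun j => vertex s (bump 0 j))) ?addF2K // => i idim.
  rewrite -(vertex_next sa sN) //.
  by rewrite {1}/bump [(_ <= i)%N]leqNgt idim.
move=> Ns; have {Ns}sN : s.1 a = N :> nat.
  by apply/eqP; rewrite eqn_leq Ns -ltnS ltn_ord.
rewrite (cN a) ?add0r => [|i _]; last exact: vertex_last_face.
apply: (c0 a) => i idim.
rewrite {1}/bump [(_ <= i)%N]leqNgt idim.
exact: vertex_next_first_face.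
Qed.

End Grid.

(** * The parity count *)

Section Replace.
Variable V : Type.
Implicit Types (f : nat -> V -> 'F_2) (w : nat -> V) (k m d : nat).

(** The cup product of [d] coboundaries; it is nonzero on a simplex exactly when
the [i]-th label changes between the vertices [w i] and [w i.+1] for all [i]. *)
Definition diff_prod d f w : 'F_2 := \prod_(i < d) (f i (w i) + f i (w i.+1)).

(** The cochain obtained from the cup product of coboundaries by putting the
0-cochain [f k + f' k] itself in place of the coboundary of [f k]. *)
Definition replace_cochain k m f f' : (nat -> V) -> 'F_2 :=
  cup_diffs k f (fun u => (f k (u 0) + f' k (u 0)) *
    cup_diffs m (fun i => f (k + i.+1)%N) (fun=> 1) u).

Lemma diff_prod_replace k m f f' w :
  (forall i, i != k -> f i = f' i) ->
  diff_prod (k + m.+1) f w + diff_prod (k + m.+1) f' w =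
  cobound (k + m.+1) (replace_cochain k m f f') w.
Proof.
move=> ff'; rewrite (cobound_cup_diffs_h k m (fun x => f k x + f' k x)).
rewrite /diff_prod !big_split_ord !big_ord_recl /cup_diffs /= !addn0 addn1 mulr1.
have ->: \prod_(i < k) (f' i (w i) + f' i (w i.+1)) =
          \prod_(i < k) (f i (w i) + f i (w i.+1)).
  by apply: eq_bigr => i _; rewrite ff' // ltn_eqF.
rewrite -mulrDr; congr (_ * _).
under [X in _ + _ * X = _]eq_bigr => i _.
  rewrite -ff'; last by rewrite -[X in _ != X]addn0 eqn_add2l.
  over.
rewrite -mulrDl; congr (_ * _); first by rewrite addrACA.
by apply: eq_bigr => i _; rewrite /bump leq0n add1n !addnS.
Qed.

Lemma replace_cochain_ext k m f f' w w' :
  (forall i, (i < k + m.+1)%N -> w i = w' i) ->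
  replace_cochain k m f f' w = replace_cochain k m f f' w'.
Proof.
move=> ww'; rewrite /replace_cochain /cup_diffs addn0.
rewrite ww' ?addnS ?ltnS ?leq_addr //; congr (_ * (_ * (_ * _))).
  apply: eq_bigr => i _; have := ltn_ord i => ik.
  by rewrite !ww' ?addnS ?ltnS ?(leq_trans ik) ?(leq_trans (ltnW ik)) ?leq_addr.
apply: eq_bigr => i _; have := ltn_ord i => im.
by rewrite !ww' ?addnS ?ltnS ?leq_add2l ?(ltnW im) // -addnS leq_add2l.
Qed.

(** On a simplex where the labels of index [a] are constant, the factor of index
[a] is either the coboundary of a constant or, if [a] is [k], the difference of
two equal constants. *)
Lemma replace_cochain_eq0 k m f f' w a v : (a < k + m.+1)%N ->
  (forall i, (i < k + m.+1)%N -> f a (w i) = v) ->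
  (forall i, (i < k + m.+1)%N -> f' a (w i) = v) ->
  replace_cochain k m f f' w = 0.
Proof.
move=> ad fv f'v; rewrite /replace_cochain /cup_diffs addn0 mulr1.
have kd : (k < k + m.+1)%N by rewrite addnS ltnS leq_addr.
case: (ltngtP a k) => [ak|ka|ak]; last first.
- by move: fv f'v; rewrite ak => -> // -> //; rewrite addF2K mul0r mulr0.
- have am : (a - k.+1 < m)%N.
    by rewrite ltn_subLR // addSnnS.
  rewrite (bigD1 (Ordinal am)) //= addnS -addSn subnKC //.
  rewrite !fv ?addF2K ?mul0r ?mulr0 //.
  by rewrite ltn_add2l ltnS ltnW.
- rewrite (bigD1 (Ordinal ak)) //= !fv ?addF2K ?mul0r //.
  by rewrite (leq_ltn_trans ak).
Qed.

End Replace.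

Section Count.
Variables n N : nat.
Local Notation dim := n.+1.
Local Notation point := ('I_dim -> nat).
Implicit Types (f : nat -> point -> 'F_2).

Definition face_labels f := forall (a : 'I_dim) (x : point),
  (x a = 0%N -> f a x = 0) /\ (x a = N.+1 -> f a x = 1).

Definition crossings f : 'F_2 := \sum_s diff_prod dim f (@vertex n N s).

(** The two counts differ by the integral of a coboundary, which is zero by
Stokes' formula: on a side of the cube orthogonal to direction [a] the labels of
index [a] are constant. *)
Lemma crossings_replace k f f' : (k < dim)%N ->
  face_labels f -> face_labels f' -> (forall i, i != k -> f i = f' i) ->
  crossings f = crossings f'.
Proof.
move=> kn lf lf' ff'; apply/eqP; rewrite -subr_eq0.
have -> : - crossings f' = crossings f'.
  by apply/eqP; rewrite eq_sym -addr_eq0 addF2K.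
have dimE : dim = (k + (n - k).+1)%N by rewrite addnS subnKC.
rewrite -big_split /=; apply/eqP.
apply: etrans (@stokes n N (replace_cochain k (n - k) f f') _ _ _).
- apply: eq_bigr => s _.
  by have := @diff_prod_replace _ k (n - k) f f' (vertex s) ff'; rewrite -dimE.
- by move=> w w' ww'; apply: replace_cochain_ext; rewrite -dimE.
- move=> a w wa; apply: (@replace_cochain_eq0 _ _ _ _ _ _ a 0).
  + by rewrite -dimE.
  + by move=> i; rewrite -dimE => id; apply: (lf a _).1; exact: wa.
  + by move=> i; rewrite -dimE => id; apply: (lf' a _).1; exact: wa.
- move=> a w wa; apply: (@replace_cochain_eq0 _ _ _ _ _ _ a 1).
  + by rewrite -dimE.
  + by move=> i; rewrite -dimE => id; apply: (lf a _).2; exact: wa.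
  + by move=> i; rewrite -dimE => id; apply: (lf' a _).2; exact: wa.
Qed.

Definition coord_label (i : nat) (x : point) : 'F_2 := (0 < x (inord i))%N%:R.

Lemma coord_labels : face_labels coord_label.
Proof.
by move=> a x; rewrite /coord_label inord_val; split=> ->.
Qed.

(** The label [0 < x i] changes at step [i] of the path only if the path starts
with coordinate [i] equal to 0 and increases it at that step, so only the path
that starts at the origin and increases the coordinates in order counts. *)
Lemma crossings_coord : crossings coord_label = 1.
Proof.
rewrite /crossings (bigD1 ([ffun=> ord0], 1%g)) //= [X in _ + X]big1 ?addr0.
  rewrite /diff_prod big1 // => i _.
  by rewrite /coord_label inord_val /vertex /= ffunE perm1 ltnn leqnn add0r.
move=> [b r] ne; apply/eqP; apply: contraNT ne => /prodf_neq0 H.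
have {}H (i : 'I_dim) : b i = ord0 /\ r i = i.
  have := H i isT; rewrite /coord_label inord_val /vertex /= ltnS.
  case: (ltngtP (r i) i) => ri; rewrite ?addn0 ?addn1 ?addF2K ?eqxx //.
  case E : (b i == 0%N :> nat); last by rewrite lt0n E addF2K eqxx.
  by move=> _; split; apply: val_inj => //; apply/eqP.
rewrite xpair_eqE; apply/andP; split; apply/eqP.
  by apply/ffunP => i; rewrite ffunE (H i).1.
by apply/permP => i; rewrite perm1 (H i).2.
Qed.

(** The labels are replaced by the coordinate labels one index at a time. *)
Lemma crossings_eq1 f : face_labels f -> crossings f = 1.
Proof.
move=> lf; pose F k i := if (i < k)%N then coord_label i else f i.
have lF k : face_labels (F k).
  by move=> a x; rewrite /F; case: ifP => _; [exact: coord_labels|exact: lf].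
have FE k : (k <= dim)%N -> crossings (F k) = crossings f.
  elim: k => [//|k IH] kn; rewrite -IH ?(ltnW kn) //.
  apply: (@crossings_replace k) => // i ik.
  by rewrite /F ltnS leq_eqVlt (negbTE ik).
rewrite -(FE dim) // -crossings_coord; apply: eq_bigr => s _.
by apply: eq_bigr => i _; rewrite /F ltn_ord.
Qed.

(** Cubical form of Sperner's lemma: a simplex with nonzero contribution to the
count lies in such a grid cube. *)
Lemma ex_fully_labelled f : face_labels f ->
  exists b : 'I_dim -> 'I_N.+1, forall a : 'I_dim, exists x y : point,
    [/\ forall c, (b c <= x c <= (b c).+1)%N,
        forall c, (b c <= y c <= (b c).+1)%N & f a x != f a y].
Proof.
move=> /crossings_eq1 T1.
have [s _ /prodf_neq0 sP] :
    exists2 s, true & diff_prod dim f (@vertex n N s) != 0.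
  apply/exists_inP; apply: contraT => /exists_inPn H.
  have := oner_neq0 'F_2; rewrite -T1 /crossings big1 ?eqxx // => s sT.
  by apply/eqP; have := H s sT; rewrite negbK.
exists (fun c => s.1 c) => a; exists (vertex s a), (vertex s a.+1).
have vP i c : (s.1 c <= vertex s i c <= (s.1 c).+1)%N.
  by rewrite /vertex; case: (_ < i)%N; rewrite ?addn1 ?addn0 leqnn leqnSn.
split=> //; apply: contra (sP a isT) => /eqP ->.
by rewrite addF2K.
Qed.

End Count.

(** * The Poincare-Miranda theorem *)

Section Miranda.
Variable R : realType.

Definition cube n : set 'rV[R]_n := [set u | forall i, -1 <= u 0 i <= 1].

Lemma compact_cube n : compact (@cube n).
Proof.
have := @rV_compact R n (fun=> `[-1, 1]%classic) (fun=> @segment_compact _ _ _).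
by congr compact; apply/seteqP; split=> u uP i; have := uP i; rewrite /= in_itv.
Qed.

Definition grid_point n N (x : 'I_n -> nat) : 'rV[R]_n :=
  \row_c (-1 + 2 * (x c)%:R / N.+1%:R).

Lemma grid_point_cube n N (x : 'I_n -> nat) :
  (forall c, (x c <= N.+1)%N) -> cube (grid_point N x).
Proof.
move=> xN c; rewrite mxE -mulrA; set t := _ / _.
have : 0 <= t <= 1 by rewrite divr_ge0 //= ler_pdivrMr // mul1r ler_nat.
lra.
Qed.

(** Label a grid point by the sign of [G k]; forcing the labels on the two sides
orthogonal to direction [k] is consistent with the weak sign conditions there. *)
Lemma ex_small_sign_change n N (G : 'I_n -> 'rV[R]_n -> R) :
  (forall k u, cube u -> u 0 k = -1 -> G k u <= 0) ->
  (forall k u, cube u -> u 0 k = 1 -> 0 <= G k u) ->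
  exists2 p, cube p & forall k, exists y z,
    [/\ cube y /\ (forall i, `|p 0 i - y 0 i| <= 2 / N.+1%:R),
        cube z /\ (forall i, `|p 0 i - z 0 i| <= 2 / N.+1%:R),
        G k y <= 0 & 0 <= G k z].
Proof.
case: n G => [|n] G Glo Ghi; first by exists 0 => [[]//|[]].
pose pos (k : 'I_n.+1) (x : 'I_n.+1 -> nat) :=
  (0 < x k)%N && ((N < x k)%N || (0 < G k (grid_point N x))).
pose f (i : nat) x : 'F_2 := (pos (inord i) x)%:R.
have fl : @face_labels n N f.
  move=> a x; rewrite /f /pos inord_val.
  by split=> ->; rewrite ?ltnn ?ltnSn.
have [b bP] := ex_fully_labelled fl.
have bN c : (b c <= N)%N by rewrite -ltnS.
have cubeP (x : 'I_n.+1 -> nat) : (forall c, (b c <= x c <= (b c).+1)%N) ->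
    cube (grid_point N x) /\
    forall i, `|grid_point N b 0 i - grid_point N x 0 i| <= 2 / N.+1%:R.
  move=> bx; split=> [|i].
    apply: grid_point_cube => c; have /andP[_ /leq_trans] := bx c; apply.
    by rewrite ltnS.
  rewrite !mxE opprD addrACA subrr add0r -mulrBl -mulrBr !normrM normfV !normr_nat.
  rewrite ler_wpM2r ?invr_ge0 //.
  rewrite -[leRHS]mulr1 ler_wpM2l // distrC.
  have /andP[b1 b2] := bx i; rewrite -natrB // ger0_norm // lern1.
  by rewrite leq_subLR addn1.
have posP k x : (forall c, (b c <= x c <= (b c).+1)%N) -> pos k x ->
    0 <= G k (grid_point N x).
  move=> bx /andP[_ /orP[Nx|/ltW//]].
  apply: Ghi; first by case: (cubeP x bx).
  have xk : x k = N.+1.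
    apply/eqP; rewrite eqn_leq Nx andbT.
    by have /andP[_ /leq_trans] := bx k; apply.
  by rewrite mxE xk mulfK ?pnatr_eq0 //; lra.
have negP k x : (forall c, (b c <= x c <= (b c).+1)%N) -> ~~ pos k x ->
    G k (grid_point N x) <= 0.
  move=> bx; rewrite negb_and -eqn0Ngt => /orP[/eqP xk|].
    apply: Glo; first by case: (cubeP x bx).
    by rewrite mxE xk mulr0 mul0r addr0.
  by rewrite negb_or -leNgt => /andP[].
exists (grid_point N b).
  by apply: grid_point_cube => c; rewrite ltnW // ltnS.
move=> k; have [x [y [bx by_]]] := bP k.
rewrite /f inord_val.
case px : (pos k x); case py : (pos k y); rewrite ?eqxx // => _.
- exists (grid_point N y), (grid_point N x); split; [exact: cubeP..| |].
    by apply: negP => //; rewrite py.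
  exact: posP.
- exists (grid_point N x), (grid_point N y); split; [exact: cubeP..| |].
    by apply: negP => //; rewrite px.
  exact: posP.
Qed.

(** Positivity persists on all small cubes near [u], uniformly in their centre:
the form of continuity that the covering formulation of compactness uses. *)
Lemma near_pos n (g : 'rV[R]_n -> R) (u : 'rV[R]_n) :
  {for u, continuous g} -> 0 < g u ->
  \forall p \near u & N \near \oo, forall y : 'rV[R]_n,
    (forall i, `|(p : 'rV[R]_n) 0 i - y 0 i| <= 2 / N.+1%:R) -> 0 < g y.
Proof.
move=> gu gu0.
have : \forall y \near u, 0 < g y by apply: (cvgr_gt (g u) gu).
move=> /nbhs_ballP[e /= e0 eP].
have e4 : 0 < e / 4 by rewrite divr_gt0.
near=> p N => y py; apply: eP; split=> // i j; rewrite ord1.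
have up : ball u (e / 2) p by near: p; apply: nbhsx_ballx; rewrite divr_gt0.
have := up.2 0 j; rewrite /ball /= => upj.
have : N.+1%:R^-1 < e / 4.
  near: N; exact: (near_infty_natSinv_lt (PosNum e4)).
have := py j; set t := _^-1 => pyj te.
rewrite -(subrKA (p 0 j)) (le_lt_trans (ler_normD _ _)) //.
lra.
Unshelve. all: by end_near. Qed.

(** Without a common zero, each point of the cube has a neighbourhood on which
some [G k] has a constant sign.  By compactness all sufficiently small cubes then
carry a component of constant sign, against [ex_small_sign_change]. *)
Theorem poincare_miranda n (G : 'I_n -> 'rV[R]_n -> R) :
  (forall k u, cube u -> {for u, continuous (G k)}) ->
  (forall k u, cube u -> u 0 k = -1 -> G k u <= 0) ->
  (forall k u, cube u -> u 0 k = 1 -> 0 <= G k u) ->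
  exists2 u, cube u & forall k, G k u = 0.
Proof.
move=> Gc Glo Ghi; apply: contrapT => no0.
have /compact_near_coveringP cov := @compact_cube n.
pose P (N : nat) (p : 'rV[R]_n) := exists k,
  (forall y : 'rV[R]_n,
     (forall i, `|p 0 i - y 0 i| <= 2 / N.+1%:R) -> 0 < G k y)
  \/ (forall y : 'rV[R]_n,
       (forall i, `|p 0 i - y 0 i| <= 2 / N.+1%:R) -> 0 < - G k y).
have : \forall N \near \oo, @cube n `<=` P N.
  apply: cov => u uK.
  have [k /eqP] : exists k, G k u <> 0.
    apply: contrapT => /forallNP H; apply: no0; exists u => // k.
    exact: contrapT.
  rewrite neq_lt => /orP[] Gu.
    have := @near_pos n (\- G k) u; rewrite /= oppr_gt0.
    move=> /(_ (continuousN (Gc k u uK)) Gu); apply: filterS => -[p N] /= pN.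
    by exists k; right.
  have := @near_pos n _ u (Gc k u uK) Gu; apply: filterS => -[p N] /= pN.
  by exists k; left.
move=> [N _ /(_ N (leqnn _))]; rewrite /= => KP.
have [p pK pP] := ex_small_sign_change N Glo Ghi.
have [k [] Gk] := KP p pK; have [y [z [[_ py] [_ pz] Gy Gz]]] := pP k.
  by have := Gk y py; rewrite ltNge Gy.
by have := Gk z pz; rewrite oppr_gt0 ltNge Gz.
Qed.

End Miranda.

(** * Pushing points of the cone off the base *)

(** A homeomorphism of an open subspace as a pair of maps between the ambient
types, which avoids carrying membership proofs; the value of [F] outside [U] is
arbitrary. *)
Lemma open_chart (X Y : topologicalType) (U : set X) (x : X) :
  open U -> U x -> homeomorphic (set_type U) Y ->
  exists (F : X -> Y) (H : Y -> X),
    [/\ {in U, continuous F}, continuous H, forall y, U (H y),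
        cancel H F & {in U, cancel F H}].
Proof.
move=> oU Ux [f [g [fc gc fK gK]]].
pose s0 : U := exist _ x (mem_set Ux).
pose F := valL_ (f s0) f.
have Fval (s : U) : F (val s) = f s by have := congr1 (@^~ s) (valLK (f s0) f).
exists F, (fun y => val (g y)); split.
- rewrite -continuous_open_subspace //.
  exact/subspace_valL_continuousP'.
- move=> y; apply: continuous_comp; first exact: gc.
  exact: initial_continuous.
- by move=> y; apply: set_valP.
- by move=> y; rewrite Fval gK.
- by move=> z zU; rewrite -[z]/(val (exist _ z zU : U)) Fval fK.
Qed.

Section Cone.
Variables (R : realType) (M : topologicalType).
Local Notation I := (`[0, 1 : R]%classic).
Local Notation C := (cone R M).
Local Notation pc := (\pi_C : M * I -> C).

(** The cone coordinate of [z].  The apex has many representatives, but all of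
them have height 1. *)
Definition height (z : C) : R := val (repr z).2.

Lemma height_bounds (z : C) : 0 <= height z <= 1.
Proof. by have := set_valP (repr z).2; rewrite /= in_itv. Qed.

Lemma pc_inj (x y : M * I) : val x.2 < 1 -> pc x = pc y -> x = y.
Proof.
move=> x1 /eqmodP; rewrite /= /collapse_rel => /orP[/eqP//|/andP[+ _]].
rewrite inE /= => x1'; have /eqP[] := negbT (lt_eqF x1).
exact: x1'.
Qed.

Lemma repr_pc (x : M * I) : val x.2 < 1 -> repr (pc x) = x.
Proof. by move=> x1; apply/esym/pc_inj => //; rewrite reprK. Qed.

(** Away from the apex the quotient map is injective and open, so that the choice
of representatives is its continuous inverse there. *)
Lemma repr_continuous (z : C) :
  height z < 1 -> {for z, continuous (repr : C -> M * I)}.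
Proof.
move=> z1 W; rewrite nbhsE => -[V [oV Vz] VW].
pose V' := V `&` [set x | (val x.2 : R) < 1].
have oV1 : open V'.
  apply: openI => //.
  rewrite -[X in open X]/((fun x : M * I => (val x.2 : R)) @^-1`
                          [set r | r < 1]).
  apply: open_comp; last exact: open_lt.
  move=> x _; apply: continuous_comp; first exact: cvg_snd.
  exact: initial_continuous.
have piV' : pc @^-1` (pc @` V') = V'.
  apply/seteqP; split=> [x [y [Vy y1] /(pc_inj y1) <-]|x xV] //.
  by exists x.
apply: (filterS _ (_ : nbhs z (pc @` V'))).
  by move=> _ [x [Vx x1] <-]; apply: VW; rewrite repr_pc.
apply: open_nbhs_nbhs; split; last by exists (repr z) => //; exact: reprK.
by rewrite /open /= /quotient_open piV'.
Qed.

Lemma height_continuous (z : C) : height z < 1 -> {for z, continuous height}.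
Proof.
move=> /repr_continuous rc.
apply: (cvg_comp _ (fun x : M * I => (val x.2 : R)) rc).
apply: continuous_comp; first exact: cvg_snd.
exact: initial_continuous.
Qed.

Definition clamp01 (r : R) : I.
Proof.
exists (Num.max 0 (Num.min r 1)); apply: mem_set; rewrite /= in_itv /=.
by rewrite le_max lexx /= ge_max ler01 ge_min lexx orbT.
Defined.

Lemma clamp01_continuous : continuous clamp01.
Proof.
apply: continuous_comp_initial => r.
rewrite /continuous_at.
have : {for r, continuous ((fun=> 0 : R) \max (id \min (fun=> 1 : R)))}.
  apply: continuous_max; first exact: cvg_cst.
  by apply: continuous_min; [exact: cvg_id | exact: cvg_cst].
exact.
Qed.

(** The push: [z] is moved along its ray up to height [s], unless it is already
higher.  The truncation only serves to make [raise z] defined for all [s]. *)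
Definition raise (z : C) (s : R) : C :=
  pc ((repr z).1, clamp01 (Num.max (height z) s)).

Lemma raise0 (z : C) : raise z 0 = z.
Proof.
rewrite /raise -[RHS]reprK; congr (\pi _).
have /andP[z0 z1] := height_bounds z.
case E : (repr z) => [x t] /=; congr (_, _); apply: val_inj => /=.
have <- : height z = \val t by rewrite /height E.
by rewrite (max_l z0) (min_l z1) max_r.
Qed.

Lemma raise_eq_base (z : C) (s : R) (p : M) :
  raise z s = pc (p, clamp01 0) -> z = pc (p, clamp01 0) /\ s <= 0.
Proof.
have v0 : val (clamp01 0) = 0 :> R by rewrite /= min_l // max_l.
move=> /esym /pc_inj; rewrite v0 ltr01 => /(_ isT) [pE tE].
have /andP[z0 z1] := height_bounds z.
have {tE} : Num.max (height z) s = 0.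
  have := etrans (esym v0) tE; case: (leP (Num.max (height z) s) 1) => _.
    by rewrite max_r // le_max z0.
  by rewrite max_r //; lra.
move=> m0; have h0 : height z <= 0 by rewrite -m0 le_max lexx.
split; last by rewrite -m0 le_max lexx orbT.
rewrite -[LHS]reprK; congr (\pi _); rewrite pE.
move: h0 z0; rewrite /height; case: (repr z) => [x t] /= h0 z0.
by congr (_, _); apply: val_inj; rewrite v0; apply/eqP; rewrite eq_le h0 z0.
Qed.

Lemma raise_continuous (z : C) (s : R) : height z < 1 ->
  {for (z, s), continuous (fun zs => raise zs.1 zs.2)}.
Proof.
move=> z1; rewrite /raise.
have rc : repr (zs.1 : C) @[zs --> (z, s)] --> (repr z : M * I).
  by apply: (cvg_comp _ _ cvg_fst); exact: repr_continuous.
have c1 : (repr (zs.1 : C)).1 @[zs --> (z, s)] --> ((repr z).1 : M).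
  by apply: (cvg_comp _ _ rc); exact: cvg_fst.
have ch : {for (z, s), continuous (fun zs : C * R => height zs.1)}.
  by apply: (cvg_comp _ _ cvg_fst); exact: height_continuous.
have c2 : clamp01 (Num.max (height (zs.1 : C)) (zs.2 : R)) @[zs --> (z, s)] -->
    clamp01 (Num.max (height z) s).
  have cm : {for (z, s), continuous ((fun zs : C * R => height zs.1) \max snd)}.
    by apply: continuous_max => //; exact: cvg_snd.
  exact: (cvg_comp _ _ cm (@clamp01_continuous _)).
have pcc : continuous pc by exact: pi_continuous.
have c12 : ((repr (zs.1 : C)).1, clamp01 (Num.max (height zs.1) (zs.2 : R)))
    @[zs --> (z, s)] --> (((repr z).1, clamp01 (Num.max (height z) s)) : M * I).
  exact: (cvg_pair c1 c2).
exact: (cvg_comp _ _ c12 (pcc _)).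
Qed.

End Cone.

(** * Base points are not Euclidean *)

Section Bump.
Variables (R : realType) (n : nat).
Implicit Types u : 'rV[R]_n.

(** A bump function: positive inside the cube and zero on its boundary. *)
Definition tent u : R := \prod_i Num.max 0 (1 - `|u 0 i|).

Lemma tent_ge0 u : 0 <= tent u.
Proof. by apply: prodr_ge0 => i _; rewrite le_max lexx. Qed.

Lemma tent_le1 u : tent u <= 1.
Proof.
apply: prodr_ile1 => i _; rewrite le_max lexx /= ge_max ler01 /=.
by rewrite lerBlDr lerDl.
Qed.

Lemma tent0 : tent 0 = 1.
Proof. by rewrite /tent big1 // => i _; rewrite mxE normr0 subr0 max_r. Qed.

Lemma tent_face u k : `|u 0 k| = 1 -> tent u = 0.
Proof.
by move=> uk; apply/eqP/prodf_eq0; exists k; rewrite // uk subrr maxxx.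
Qed.

Lemma tent_continuous : continuous tent.
Proof.
move=> u; apply: (cvg_big (@mul_continuous R) (nbhs_filter u)) => i _.
have ci : {for u, continuous (fun v : 'rV[R]_n => 1 - `|v 0 i|)}.
  apply: continuousB; first exact: cst_continuous.
  by apply: continuous_comp; [exact: coord_continuous|exact: norm_continuous].
by have := continuous_max (@cst_continuous _ _ 0 u) ci; exact.
Qed.

End Bump.

Section Main.
Variables (R : realType) (M : topologicalType).
Local Notation I := (`[0, 1 : R]%classic).
Local Notation C := (cone R M).
Local Notation pc := (\pi_C : M * I -> C).

(** [F] and [H] are the chart and its inverse, and [G] is the push of a cube of
half side [r] by a multiple of the tent function, read in the chart relative to
the centre [y0] of the cube.  A zero of [G] is a point that the push moves to
[q]; such a point would be [q] itself, which the push moves off the base. *)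
Lemma cone_base_not_euclidean (p : M) n (U : set C) :
  open U -> U (pc (p, clamp01 0)) -> ~ homeomorphic (set_type U) 'rV[R]_n.
Proof.
set q := pc _ => oU Uq homU.
have [F [H [Fc Hc HU HK FK]]] := open_chart oU Uq homU.
have {}FK z : U z -> H (F z) = z by move=> Uz; apply: FK; rewrite inE.
set y0 := F q.
have Hy0 : H y0 = q by exact: FK.
have hq : height q = 0.
  by rewrite /height repr_pc /= ?min_l ?max_l.
have rc (y : 'rV[R]_n) (s : R) : height (H y) < 1 ->
    {for (y, s), continuous (fun ys : 'rV[R]_n * R => raise (H ys.1) ys.2)}.
  move=> y1.
  have c1 : (H (ys.1 : 'rV[R]_n), (ys.2 : R)) @[ys --> (y, s)] -->
      ((H y, s) : C * R).
    have cH : H (ys.1 : 'rV[R]_n) @[ys --> (y, s)] --> (H y : C).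
      by apply: (cvg_comp _ _ cvg_fst); exact: Hc.
    exact: (cvg_pair cH cvg_snd).
  exact: (cvg_comp _ _ c1 (raise_continuous y1)).
(* at [y0] no push takes place, so continuity keeps small pushes in the chart *)
have [e e0 eP] : exists2 e : R, 0 < e & forall y s, ball y0 e y -> `|s| < e ->
    U (raise (H y) s) /\ height (H y) < 1.
  have Hq1 : height (H y0) < 1 by rewrite Hy0 hq.
  have h1 : \forall y \near y0, height (H y) < 1.
    have hc : {for y0, continuous (@height R M \o H)}.
      by apply: continuous_comp; [exact: Hc|exact: height_continuous].
    exact: (cvgr_lt (height (H y0)) hc 1 Hq1).
  have h2 : \forall ys \near (y0, 0 : R), U (raise (H ys.1) ys.2).
    by apply: (rc y0 0 Hq1); apply: open_nbhs_nbhs; rewrite /= raise0 Hy0.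
  have [e1 /= e10 e1P] := (nbhs_ballP _ _).1 h1.
  have [e2 /= e20 e2P] := (nbhs_ballP _ _).1 h2.
  exists (Num.min e1 e2); first by rewrite lt_min e10.
  move=> y s ys s12; split.
    apply: (e2P (y, s)); split=> /=.
      by apply: le_ball ys; rewrite ge_min lexx orbT.
    by rewrite /ball /= sub0r normrN (lt_le_trans s12) // ge_min lexx orbT.
  by apply: e1P; apply: le_ball ys; rewrite ge_min lexx.
pose r := e / 2; have r0 : 0 < r by rewrite divr_gt0.
pose Y (u : 'rV[R]_n) := y0 + r *: u.
pose lam (u : 'rV[R]_n) := r * tent u.
have lamr u : 0 <= lam u <= r.
  by rewrite mulr_ge0 ?tent_ge0 ?(ltW r0) //= ler_piMr ?tent_le1 // ltW.
have YP u : cube u -> U (raise (H (Y u)) (lam u)) /\ height (H (Y u)) < 1.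
  move=> uK; apply: eP; last first.
    have /andP[l0 lr] := lamr u; rewrite ger0_norm //.
    by rewrite (le_lt_trans lr) // /r; lra.
  split=> // i j; rewrite ord1 /ball /= !mxE opprD addNKr normrN normrM.
  rewrite gtr0_norm //.
  have : `|u 0 j| <= 1 by rewrite ler_norml.
  by rewrite -(ler_pM2l r0) mulr1 => /le_lt_trans; apply; rewrite /r; lra.
pose G (k : 'I_n) u := F (raise (H (Y u)) (lam u)) 0 k - y0 0 k.
(* on the boundary of the cube the tent function vanishes *)
have Gface k (u : 'rV[R]_n) : `|u 0 k| = 1 -> G k u = r * u 0 k.
  move=> /tent_face uk; rewrite /G /lam uk mulr0 raise0 HK /Y !mxE.
  by rewrite addrAC subrr add0r.
have [||| u uK Gu] := @poincare_miranda R n G.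
- move=> k u uK; have [Uu hu] := YP u uK.
  apply: continuousB; last exact: cst_continuous.
  have cY : {for u, continuous Y}.
    apply: continuousD; first exact: cst_continuous.
    by apply: continuousZr; exact: cvg_id.
  have cl : {for u, continuous lam}.
    apply: continuousM; first exact: cst_continuous.
    exact: tent_continuous.
  have cYl : (Y v, lam v) @[v --> u] --> ((Y u, lam u) : 'rV[R]_n * R).
    exact: (cvg_pair cY cl).
  have cF := cvg_comp _ _ (cvg_comp _ _ cYl (rc _ _ hu)) (Fc _ (mem_set Uu)).
  exact: (cvg_comp _ _ cF (@coord_continuous _ _ _ 0 k _)).
- by move=> k u uK uk; rewrite Gface uk ?normrN ?normr1 // mulrN1 oppr_le0 ltW.
- by move=> k u uK uk; rewrite Gface uk ?normr1 // mulr1 ltW.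
have Fu : F (raise (H (Y u)) (lam u)) = y0.
  by apply/rowP => k; apply/eqP; rewrite -subr_eq0; apply/eqP/Gu.
have /raise_eq_base[Hq lam0] : raise (H (Y u)) (lam u) = q.
  by rewrite -[LHS]FK ?Fu //; case: (YP u uK).
have u0 : u = 0.
  have : Y u = y0 by rewrite -[LHS]HK Hq.
  move/eqP; rewrite /Y -subr_eq0 addrAC subrr add0r scaler_eq0 gt_eqF //=.
  by move/eqP.
by move: lam0; rewrite /lam u0 tent0 mulr1 leNgt r0.
Qed.

End Main.

Theorem theorem2p3 (R : realType) (M : topologicalType)
    (M_nonempty : [set: M] !=set0) (M_manifold : topological_manifold R M) :
  ~ topological_manifold R (cone R M).
Proof.
case: M_nonempty => p _ [n [_ _ locE]].
have [U [oU Uq]] := locE (\pi_(cone R M) (p, clamp01 0)).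
exact: cone_base_not_euclidean oU Uq.
Qed.
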